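(* Let $q$ be a power of a prime $p\ge5$. Then \[ \Theta_{\rm a}=\{27+a:\ a\ \text{is a nonsquare in}\ \mathbb F_q\}, \] and $|\Theta_{\rm a}|=(q-1)/2$.
   Context: $\mathbb F_q$ is the field with $q$ elements. Let $\Omega=\{(s,t)\in\mathbb F_q^2: t(1+s+t)\neq0\}$. For $(s,t)\in\Omega$ let $G_{s,t}(X)=X^4-2X^3-sX^2-2tX+t\in\mathbb F_q[X]$ and $\theta(s,t)=\frac{s^3}{t(1+s+t)}$. Define $\Theta_{\rm a}=\{\theta(s,t): (s,t)\in\Omega,\ G_{s,t}\ \text{is irreducible over}\ \mathbb F_q\}$. *)

(* Defs.v *)
From mathcomp Require Import all_boot all_order all_algebra.

Set Implicit Arguments.
Unset Strict Implicit.
Unset Printing Implicit Defensive.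

Import GRing.Theory.
Local Open Scope ring_scope.

Definition Omega (F : finFieldType) : {set F * F} :=
  [set st : F * F | st.2 * (1 + st.1 + st.2) != 0].

Definition G (F : finFieldType) (st : F * F) : {poly F} :=
  'X^4 - 2%:R *: 'X^3 - st.1 *: 'X^2 - (2%:R * st.2) *: 'X + st.2%:P.

Definition theta (F : finFieldType) (st : F * F) : F :=
  st.1 ^+ 3 / (st.2 * (1 + st.1 + st.2)).

(* [irreducibleb] decides [irreducible_poly] over a finite field: see
   [irreducibleP]. *)
Definition Theta_a (F : finFieldType) : {set F} :=
  [set theta st | st in Omega F & irreducibleb (G st)].

Definition is_square (F : finFieldType) (a : F) : bool :=
  [exists b : F, a == b ^+ 2].

(* Main.v *)
(* With u = t(1+s+t), the discriminant of G_{s,t} is 16 u (s^3 - 27 u), that is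
   (4u)^2 (theta - 27).  If G is irreducible, Frobenius permutes its roots by a
   4-cycle, which negates the product of the differences of the roots, so that
   theta - 27 is a nonsquare.

   Conversely, let theta - 27 be a nonsquare.  A quartic without roots whose
   discriminant is a nonsquare is irreducible, so it suffices to find (s,t) over
   theta such that G has no root.  The cubic k^3 = theta (k + 2) has discriminant
   4 theta^2 (theta - 27), hence a root k in F_q.  With v = k + 2 and s = k l,
   the equation theta(s,t) = theta becomes t(1+s+t) = v l^3, and l is then a root
   of the resolvent cubic of G, so that G = (X^2 - X + l)^2 - D (X + (t-l)/D)^2
   with D = 1 + v l; such a G has no root if D is a nonsquare.  The equation for
   t is solvable iff D (4 l^2 + (k-2) l + 1) is a square.  The quadratic factor
   has nonsquare discriminant, so it takes square values at exactly (q-1)/2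
   points; counting gives an l where both factors are nonsquares, provided the
   quadratic is a square at the zero l = -1/v of D.  Otherwise this zero itself
   works, as then G = (X^2 - X + l)^2 - (l^2 - l) with l^2 - l a nonsquare. *)
From HB Require Import structures.
Require Import Defs.
From mathcomp Require Import all_boot all_order all_algebra all_field.
From mathcomp Require Import ring zify.

Set Implicit Arguments.
Unset Strict Implicit.
Unset Printing Implicit Defensive.

Import GRing.Theory.
Local Open Scope ring_scope.

(** * Counting squares and nonsquares in a finite field *)

Lemma card_imset_two_to_one (T U : finType) (f : T -> U) (g : T -> T)
    (S : {set T}) :
    {in S, forall x, g x \in S} -> {in S, forall x, g x != x} ->
    {in S &, forall x y, (f y == f x) = (y == x) || (y == g x)} ->
  #|S| = (#|f @: S|).*2.
Proof.
move=> gS gN fE; rewrite -sum1_card (partition_big_imset f) /= -muln2.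
rewrite -[X in (X * _)%N]sum1_card big_distrl /=.
apply: eq_bigr => _ /imsetP[x xS ->]; rewrite mul1n sum1dep_card.
transitivity #|[set x; g x]|; last by rewrite cards2 eq_sym gN.
apply: eq_card => y; rewrite !inE.
case: (boolP (y \in S)) => [yS | yS] /=; first exact: fE.
by apply/esym/negP => /orP[] /eqP e; rewrite e ?xS ?gS in yS.
Qed.

Lemma is_squareP (F : finFieldType) (a : F) :
  reflect (exists b, a = b ^+ 2) (is_square a).
Proof. by apply: (iffP existsP) => -[b /eqP ?]; exists b => //; apply/eqP. Qed.

Lemma is_squareX2 (F : finFieldType) (a : F) : is_square (a ^+ 2).
Proof. by apply/is_squareP; exists a. Qed.

Lemma is_squareM2 (F : finFieldType) (a b : F) :
  b != 0 -> is_square (b ^+ 2 * a) = is_square a.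
Proof.
move=> b0; apply/is_squareP/is_squareP => -[c e].
  by exists (c / b); rewrite expr_div_n -e mulrC mulKf ?expf_neq0.
by exists (b * c); rewrite exprMn e.
Qed.

Lemma nonsquare_neq0 (F : finFieldType) (a : F) : ~~ is_square a -> a != 0.
Proof.
by apply: contraNneq => ->; apply/is_squareP; exists 0; rewrite expr0n.
Qed.

Section OddCharacteristic.
Variable F : finFieldType.
Hypothesis two_neq0 : 2 != 0 :> F.

Let four_neq0 : 4 != 0 :> F.
Proof. by rewrite (natrM _ 2 2) mulf_neq0. Qed.

Lemma card_nonzero_squares :
  #|F|.-1 = (#|[set x ^+ 2 | x in [set~ (0 : F)]]|).*2.
Proof.
rewrite -(cardsC1 (0 : F)); apply: (card_imset_two_to_one (g := -%R)).
- by move=> x; rewrite !inE oppr_eq0.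
- move=> x; rewrite !inE; apply: contraNneq => e.
  suff : 2 * x == 0 by rewrite mulf_eq0 (negPf two_neq0).
  by rewrite mulr_natl mulr2n -[X in X + _]e addNr.
- by move=> x y _ _; rewrite eqf_sqr.
Qed.

Lemma card_nonsquares : (#|[set a : F | ~~ is_square a]|).*2 = #|F|.-1.
Proof.
have -> : [set a : F | ~~ is_square a] =
    [set~ 0] :\: [set x ^+ 2 | x in [set~ (0 : F)]].
  apply/setP => a; rewrite !inE; apply/idP/idP.
    move=> na; rewrite nonsquare_neq0 // andbT; apply: contra na.
    by case/imsetP => x _ ->; exact: is_squareX2.
  case/andP => na a0; apply: contra na => /is_squareP[b e].
  apply/imsetP; exists b => //; rewrite !inE; apply: contraNneq a0 => b0.
  by rewrite e b0 expr0n.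
rewrite cardsDS ?cardsC1; last first.
  by apply/subsetP => _ /imsetP[x x0 ->]; rewrite !inE expf_neq0 // -in_setC1.
by rewrite doubleB -card_nonzero_squares -addnn addnK.
Qed.

(** Multiplication by [a] maps the nonzero squares injectively into the nonsquares. Both sets have
    the same size, so [b] is [a] times a square. *)
Lemma nonsquareM (a b : F) :
  ~~ is_square a -> ~~ is_square b -> is_square (a * b).
Proof.
move=> na nb; have a0 := nonsquare_neq0 na.
have sub : *%R a @: [set x ^+ 2 | x in [set~ (0 : F)]] \subset
    [set c : F | ~~ is_square c].
  apply/subsetP => _ /imsetP[_ /imsetP[x x0 ->] ->]; rewrite inE mulrC.
  by move: x0; rewrite in_setC1 => x0; rewrite is_squareM2.
have /eqP E : *%R a @: [set x ^+ 2 | x in [set~ (0 : F)]] ==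
    [set c : F | ~~ is_square c].
  rewrite eqEcard sub card_imset; last exact: mulfI.
  by rewrite /= -leq_double card_nonsquares card_nonzero_squares.
have : b \in [set c : F | ~~ is_square c] by rewrite inE.
rewrite -E => /imsetP[_ /imsetP[x _ ->] ->].
by rewrite mulrA -expr2 -exprMn is_squareX2.
Qed.

(* The conic y^2 = x^2 + b x + c is the hyperbola u v = d for
   u, v = x + b/2 -+ y and d = (b^2 - 4c)/4, whence the parametrization of x
   by the unit u. *)
Lemma card_quadratic_square_values (b c : F) :
    ~~ is_square (b ^+ 2 - 4 * c) ->
  (#|[set x : F | is_square (x ^+ 2 + b * x + c)]|).*2 = #|F|.-1.
Proof.
move=> nd; pose d := (b ^+ 2 - 4 * c) / 2 ^+ 2.
have {}nd : ~~ is_square d.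
  by rewrite -(is_squareM2 _ two_neq0) /d mulrC divfK ?expf_neq0.
have d0 := nonsquare_neq0 nd.
rewrite -(cardsC1 (0 : F)).
rewrite (card_imset_two_to_one (S := [set~ 0]) (g := fun u => d / u)
   (f := fun u => (u + d / u - b) / 2)); first 1 last.
- by move=> u; rewrite !inE => u0; rewrite mulf_neq0 ?invr_eq0.
- move=> u; rewrite !inE => u0; apply: contra nd => /eqP e.
  by apply/is_squareP; exists u; rewrite -[d](divfK u0) e.
- move=> u v; rewrite !inE => u0 v0.
  rewrite (can_eq (divfK two_neq0)) (inj_eq (addIr _)).
  rewrite -subr_eq0 -[v == u]subr_eq0 -[v == d / u]subr_eq0 -mulf_eq0.
  have -> : v + d / v - (u + d / u) = (v - u) * (v - d / u) / v.
    by field; rewrite u0 v0.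
  by rewrite [LHS]mulf_eq0 invr_eq0 (negPf v0) orbF.
congr (#|pred_of_set _|).*2; apply/setP => x; rewrite inE; apply/is_squareP/imsetP.
  case=> y e.
  have dE : d = (x + b / 2 - y) * (x + b / 2 + y).
    have -> : d = (x + b / 2) ^+ 2 - (x ^+ 2 + b * x + c).
      by rewrite /d; field; rewrite two_neq0 four_neq0.
    by rewrite e; ring.
  have u0 : x + b / 2 - y != 0 by apply: contraNneq d0 => h; rewrite dE h mul0r.
  exists (x + b / 2 - y); first by rewrite !inE.
  by rewrite dE [(x + b / 2 - y) * _]mulrC mulfK //; field.
case=> u; rewrite !inE => u0 ->; exists ((u - d / u) / 2).
by rewrite /d; field; rewrite u0 two_neq0 four_neq0.
Qed.

(** Otherwise [y |-> r + y / v] sends every nonsquare to a point where the quadratic is a square.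
    There are equally many of both, yet [r] is such a point and is missed, since it would need
    [y = 0]. *)
Lemma exists_nonsquare_values (b c r v : F) :
    ~~ is_square (b ^+ 2 - 4 * c) -> v != 0 ->
    is_square (r ^+ 2 + b * r + c) ->
  exists x, ~~ is_square (v * (x - r)) && ~~ is_square (x ^+ 2 + b * x + c).
Proof.
move=> nd v0 sr; apply/existsP; apply: contraT; rewrite negb_exists => /forallP H.
have := leqnn #|F|.-1.
rewrite -[X in (X <= _)%N](card_quadratic_square_values nd) -card_nonsquares.
rewrite leq_double leqNgt => /negP[].
pose f y : F := r + y / v.
have finj : injective f by move=> y z /addrI /(mulIf (invr_neq0 v0)).
rewrite -(card_imset _ finj); apply: proper_card; apply/properP; split.
  apply/subsetP => _ /imsetP[y ny ->]; rewrite !inE in ny *.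
  move: (H (f y)); rewrite /f [r + _]addrC addrK mulrCA mulfV // mulr1 ny /=.
  by rewrite negbK.
exists r; first by rewrite inE.
apply/negP => /imsetP[y]; rewrite inE => ny /eqP.
rewrite -subr_eq0 /f opprD addrA subrr sub0r oppr_eq0 mulf_eq0 invr_eq0.
by rewrite (negPf v0) orbF (negPf (nonsquare_neq0 ny)).
Qed.

End OddCharacteristic.

(** * The Frobenius map and the roots of irreducible polynomials *)

Definition Frobenius (F : finFieldType) (L : fieldExtType F) (a : L) : L :=
  a ^+ #|F|.

Lemma Frobenius_is_zmod_morphism (F : finFieldType) (L : fieldExtType F) :
  zmod_morphism (@Frobenius F L).
Proof.
have [p p_pr pF] := finPcharP F.
have qp : [pchar L].-nat #|F|.
  rewrite (eq_pnat _ (pchar_lalg L)) (eq_pnat _ (pcharf_eq pF)).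
  have := card_pprimeChar pF; rewrite /pPrimeCharType => ->.
  by rewrite pnatX pnat_id.
move=> a b; rewrite /Frobenius exprDn_pchar //; congr (_ + _).
(* The sign is pulled out by additivity, as the powers of [b] and [- b] sum to [0]; this needs no
   parity of the exponent. *)
apply/eqP; rewrite -subr_eq0 opprK -exprDn_pchar // addNr expr0n.
by rewrite gtn_eqF // (ltn_trans _ (finNzRing_gt1 F)).
Qed.

Lemma Frobenius_is_monoid_morphism (F : finFieldType) (L : fieldExtType F) :
  monoid_morphism (@Frobenius F L).
Proof. by split=> [|a b]; rewrite /Frobenius ?expr1n ?exprMn. Qed.

HB.instance Definition _ (F : finFieldType) (L : fieldExtType F) :=
  GRing.isZmodMorphism.Build L L (@Frobenius F L)
    (@Frobenius_is_zmod_morphism F L).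

HB.instance Definition _ (F : finFieldType) (L : fieldExtType F) :=
  GRing.isMonoidMorphism.Build L L (@Frobenius F L)
    (@Frobenius_is_monoid_morphism F L).

Lemma iter_Frobenius (F : finFieldType) (L : fieldExtType F) (a : L) n :
  iter n (@Frobenius F L) a = a ^+ (#|F| ^ n)%N.
Proof.
by elim: n => [|n IHn]; rewrite ?expn0 ?expr1 //= IHn /Frobenius -exprM -expnSr.
Qed.

Lemma Frobenius_fixed (F : finFieldType) (L : fieldExtType F) (a : L) :
  Frobenius a = a -> exists c : F, a = c%:A.
Proof.
move=> fa; apply/vlineP.
by rewrite (Fermat's_little_theorem 1%AS) dimv1 expn1 -[X in X == _]/(Frobenius a) fa.
Qed.

(** Frobenius permutes the linear factors cyclically, so it fixes every coefficient of the product,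
    which therefore lies in [F]. *)
Lemma Frobenius_orbit_poly (F : finFieldType) (L : fieldExtType F) (a : L) m :
    iter m (@Frobenius F L) a = a ->
  exists P : {poly F}, map_poly (in_alg L) P =
    \prod_(i < m) ('X - (iter i (@Frobenius F L) a)%:P).
Proof.
move=> am; set P := \prod_(i < m) _.
suff /polyOver1P[Q ->] : P \is a polyOver 1%VS by exists Q.
have PE : map_poly (@Frobenius F L) P = P.
  rewrite /P map_prod_XsubC; case: m am {P} => [|m] am; first by rewrite !big_ord0.
  rewrite big_ord_recr big_ord_recl /= mulrC -[in X in X * _]iterS am.
  by congr (_ * _).
apply/polyOverP => i; apply/vlineP; apply: Frobenius_fixed.
by rewrite -[in RHS]PE coef_map.
Qed.

(** If [f] did not divide [P], the two would be coprime, and would stay so over [L], where they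
    share the root [a]. *)
Lemma irreducible_root_dvdp (F L : fieldType) (g : {rmorphism F -> L})
    (f P : {poly F}) a :
  irreducible_poly f -> root (map_poly g f) a -> root (map_poly g P) a -> f %| P.
Proof.
move=> f_irr fa Pa; rewrite -[_ %| _]negbK -(irreducible_poly_coprime _ f_irr).
apply/negP; rewrite -(coprimep_map g) => /coprimep_root /(_ fa).
by rewrite -/(root _ _) Pa.
Qed.

(** Adjoin a root [a]. The product over a closed orbit segment descends to [F] and vanishes at [a],
    so [f] divides it. Comparing degrees gives equality at full length and excludes every shorter
    period. *)
Lemma irreducible_Frobenius_orbit (F : finFieldType) (f : {poly F}) :
    irreducible_poly f -> f \is monic ->
  exists (L : fieldExtType F) (a : L),
    [/\ iter (size f).-1 (@Frobenius F L) a = a,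
        map_poly (in_alg L) f =
          \prod_(i < (size f).-1) ('X - (iter i (@Frobenius F L) a)%:P) &
        forall m, (0 < m < (size f).-1)%N -> iter m (@Frobenius F L) a != a].
Proof.
move=> f_irr f_mon; have [L dimL [a fa _]] := irredp_FAdjoin f_irr.
have f_gt1 : (1 < size f)%N by case: f_irr.
have an : iter (size f).-1 (@Frobenius F L) a = a.
  by apply/eqP; rewrite iter_Frobenius -dimL -Fermat's_little_theorem memvf.
have dvd m (P : {poly F}) : (0 < m)%N ->
    map_poly (in_alg L) P = \prod_(i < m) ('X - (iter i (@Frobenius F L) a)%:P) ->
    f %| P.
  move=> m_gt0 PE; apply: (irreducible_root_dvdp f_irr fa); rewrite PE.
  by rewrite (bigD1 (Ordinal m_gt0)) //= rootM root_XsubC eqxx.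
have szP m (P : {poly F}) :
    map_poly (in_alg L) P = \prod_(i < m) ('X - (iter i (@Frobenius F L) a)%:P) ->
    size P = m.+1.
  by move=> PE; rewrite -(size_map_poly (in_alg L)) PE size_prod_XsubC /index_enum -enumT size_enum_ord.
exists L, a; split=> //.
  have [P PE] := Frobenius_orbit_poly an; rewrite -PE; congr map_poly.
  have P_mon : P \is monic.
    by rewrite -(map_monic (in_alg L)) PE monic_prod_XsubC.
  apply/eqP; rewrite -eqp_monic // -dvdp_size_eqp ?(dvd _ _ _ PE) //.
    by rewrite (szP _ _ PE) prednK // ltnW.
  by rewrite -subn1 subn_gt0.
move=> m /andP[m_gt0 m_lt]; apply/eqP => am.
have [P PE] := Frobenius_orbit_poly am; have fP := dvd _ _ m_gt0 PE.
have := dvdp_leq _ fP; rewrite -size_poly_eq0 (szP _ _ PE) => /(_ isT).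
by rewrite leqNgt -(prednK (ltnW f_gt1)) ltnS m_lt.
Qed.

(** Without a root the cubic is irreducible, and Frobenius acts on its roots as a 3-cycle. This even
    permutation fixes the product [d] of their differences, so the discriminant [d ^+ 2] is a square
    in [F]. *)
Lemma cubic_root_of_nonsquare_disc (F : finFieldType) (a b : F) :
    ~~ is_square (- 4 * a ^+ 3 - 27 * b ^+ 2) ->
  exists x, x ^+ 3 + a * x + b = 0.
Proof.
move=> nd; pose g : {poly F} := a *: 'X + b%:P; pose f := 'X^3 + g.
have low : (size g < size ('X^3 : {poly F}))%N.
  rewrite size_polyXn ltnS; apply/leq_sizeP => -[|[|[|j]]] // _.
  by rewrite /g !coefE mulr0 addr0.
have fsz : size f = 4%N by rewrite /f size_polyDl // size_polyXn.
have f_mon : f \is monic by rewrite monicE /f lead_coefDl // lead_coefXn.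
case: (boolP [exists x, root f x]) => [/existsP[x /rootP fx] | nr].
  by exists x; rewrite -[RHS]fx /f !hornerE /=.
have f_irr : irreducible_poly f.
  apply: cubic_irreducible; first by rewrite fsz.
  by move=> x; apply: contra nr => fx; apply/existsP; exists x.
have [L [x []]] := irreducible_Frobenius_orbit f_irr f_mon.
rewrite fsz /= !big_ord_recr /= big_ord0 mul1r /=.
pose phi : {rmorphism L -> L} := @Frobenius F L.
set y := Frobenius x; set z := Frobenius y => zx fE _.
pose d := (x - y) * (y - z) * (x - z).
have dF : phi d = d.
  rewrite /d !rmorphM !rmorphB -[phi x]/y -[phi y]/z [phi z]zx; ring.
have [c dE] := Frobenius_fixed dF.
have C i : (f`_i)%:A = (('X - x%:P) * ('X - y%:P) * ('X - z%:P))`_i.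
  by rewrite -fE coef_map.
have E : ('X - x%:P) * ('X - y%:P) * ('X - z%:P) =
    'X^3 - (x + y + z) *: 'X^2 + (x * y + x * z + y * z) *: 'X
      - (x * y * z)%:P :> {poly L}.
  rewrite -!mul_polyC !rmorphD !rmorphM /=; ring.
have := C 2%N; have := C 1%N; have := C 0%N; rewrite E /f /g !coefE /=.
rewrite !(mulr0, mulr1, add0r, addr0, sub0r, subr0, oppr0, scale0r).
rewrite -![_%:A]/(in_alg L _) => bE aE /esym/eqP; rewrite oppr_eq0 => /eqP xyz.
case/negP: nd; apply/is_squareP; exists c; apply: (fmorph_inj (in_alg L)).
rewrite !(rmorphB, rmorphN, rmorphM, rmorphXn, rmorph_nat) /= -/(in_alg L c).
rewrite -![_%:A]/(in_alg L _) -[in_alg L c]/(c%:A) -dE aE bE /d.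
have -> : z = - x - y by rewrite -[LHS]subr0 -xyz; ring.
by ring.
Qed.

(** * The discriminant of a quartic, and that of [G] *)

(** The discriminant of [X^4 - e1 X^3 + e2 X^2 - e3 X + e4]. *)
Definition quartic_disc (R : comNzRingType) (e1 e2 e3 e4 : R) : R :=
  256 * e4 ^+ 3 - 192 * e1 * e3 * e4 ^+ 2 - 128 * e2 ^+ 2 * e4 ^+ 2
  + 144 * e2 * e3 ^+ 2 * e4 - 27 * e3 ^+ 4 + 144 * e1 ^+ 2 * e2 * e4 ^+ 2
  - 6 * e1 ^+ 2 * e3 ^+ 2 * e4 - 80 * e1 * e2 ^+ 2 * e3 * e4
  + 18 * e1 * e2 * e3 ^+ 3 + 16 * e2 ^+ 4 * e4 - 4 * e2 ^+ 3 * e3 ^+ 2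
  - 27 * e1 ^+ 4 * e4 ^+ 2 + 18 * e1 ^+ 3 * e2 * e3 * e4
  - 4 * e1 ^+ 3 * e3 ^+ 3 - 4 * e1 ^+ 2 * e2 ^+ 3 * e4
  + e1 ^+ 2 * e2 ^+ 2 * e3 ^+ 2.

Lemma quartic_disc_roots (R : comNzRingType) (x y z w : R) :
  quartic_disc (x + y + z + w)
    (x * y + x * z + x * w + y * z + y * w + z * w)
    (x * y * z + x * y * w + x * z * w + y * z * w) (x * y * z * w) =
  ((x - y) * (x - z) * (x - w) * (y - z) * (y - w) * (z - w)) ^+ 2.
Proof. by rewrite /quartic_disc; ring. Qed.

(** For [(X^2 + a X + b)(X^2 + c X + d)] the right side is the product of the two discriminants and
    the squared resultant. *)
Lemma quartic_disc_quadratics (R : comNzRingType) (a b c d e1 e2 e3 e4 : R) :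
    e1 = - (a + c) -> e2 = b + d + a * c -> e3 = - (a * d + b * c) ->
    e4 = b * d ->
  quartic_disc e1 e2 e3 e4 =
  (a ^+ 2 - 4 * b) * (c ^+ 2 - 4 * d)
    * ((b - d) ^+ 2 + (a - c) * (a * d - b * c)) ^+ 2.
Proof. by move=> -> -> -> ->; rewrite /quartic_disc; ring. Qed.

Lemma GE (F : finFieldType) (s t : F) :
  G (s, t) = 'X^4 - 2 *: 'X^3 - s *: 'X^2 - (2 * t) *: 'X + t%:P.
Proof. by []. Qed.

Lemma size_G_tail (F : finFieldType) (st : F * F) :
  (size (G st - 'X^4)%R <= 4)%N.
Proof.
apply/leq_sizeP => -[|[|[|[|j]]]] // _; rewrite !coefE /=.
by case: j => [|j] /=; ring.
Qed.

Lemma size_G (F : finFieldType) (st : F * F) : size (G st) = 5%N.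
Proof.
rewrite -[G st](subrK 'X^4) addrC size_polyDl size_polyXn //.
by rewrite ltnS size_G_tail.
Qed.

Lemma G_monic (F : finFieldType) (st : F * F) : G st \is monic.
Proof.
rewrite monicE -[G st](subrK 'X^4) addrC lead_coefDl ?lead_coefXn //.
by rewrite size_polyXn ltnS size_G_tail.
Qed.

Definition Gdisc (R : comNzRingType) (s t : R) : R :=
  16 * (t * (1 + s + t)) * (s ^+ 3 - 27 * (t * (1 + s + t))).

Lemma GdiscE (R : comNzRingType) (s t : R) :
  Gdisc s t = quartic_disc 2 (- s) (2 * t) t.
Proof. by rewrite /Gdisc /quartic_disc; ring. Qed.

Lemma irreducible_G_disc (F : finFieldType) (s t : F) :
  2 != 0 :> F -> irreducible_poly (G (s, t)) -> ~~ is_square (Gdisc s t).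
Proof.
move=> two_neq0 G_irr; apply/negP => /is_squareP[c discE].
have [L [x []]] := irreducible_Frobenius_orbit G_irr (G_monic _).
rewrite size_G /= !big_ord_recr big_ord0 /= mul1r.
pose phi : {rmorphism L -> L} := @Frobenius F L.
set y := Frobenius x; set z := Frobenius y; set w := Frobenius z => wx fE neq.
have xy : y != x by exact: (neq 1%N).
have xz : z != x by exact: (neq 2%N).
have xw : w != x by exact: (neq 3%N).
have phi_inj : injective phi := fmorph_inj phi.
have yz : z != y by rewrite -(inj_eq phi_inj) in xy.
have zw : w != z by rewrite -(inj_eq phi_inj) in yz.
have yw : w != y by rewrite -(inj_eq phi_inj) in xz.
pose d := (x - y) * (x - z) * (x - w) * (y - z) * (y - w) * (z - w).
have dF : phi d = - d.
  rewrite /d !rmorphM !rmorphB -[phi x]/y -[phi y]/z -[phi z]/w [phi w]wx; ring.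
have C i : ((G (s, t))`_i)%:A =
    (('X - x%:P) * ('X - y%:P) * ('X - z%:P) * ('X - w%:P))`_i.
  by rewrite -fE coef_map.
have E : ('X - x%:P) * ('X - y%:P) * ('X - z%:P) * ('X - w%:P) =
    'X^4 - (x + y + z + w) *: 'X^3
      + (x * y + x * z + x * w + y * z + y * w + z * w) *: 'X^2
      - (x * y * z + x * y * w + x * z * w + y * z * w) *: 'X
      + (x * y * z * w)%:P :> {poly L}.
  rewrite -!mul_polyC !rmorphD !rmorphM /=; ring.
have := C 3%N; have := C 2%N; have := C 1%N; have := C 0%N; rewrite E GE !coefE /=.
rewrite !(mulr0, mulr1, add0r, addr0, sub0r, subr0, oppr0, scale0r).
rewrite -![_%:A]/(in_alg L _).
rewrite !(rmorphB, rmorphN, rmorphM, rmorphXn, rmorph_nat) => e4 /oppr_inj e3 e2 /oppr_inj e1.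
have dE : d ^+ 2 = in_alg L c ^+ 2.
  rewrite -rmorphXn -discE /d -quartic_disc_roots -e1 -e2 -e3 -e4 -GdiscE /Gdisc.
  by rewrite !(rmorphB, rmorphD, rmorphN, rmorphM, rmorphXn, rmorph_nat, rmorph1).
(* As a square root of [c ^+ 2], [d] is [c] or [- c], hence in [F] and fixed by Frobenius. With [dF]
   this forces [2 * d = 0], against the distinctness of the roots. *)
have dF' : phi d = d.
  have phic : phi (in_alg L c) = in_alg L c.
    by rewrite /phi /= /Frobenius exprZn expr1n expf_card.
  by move/eqP: dE; rewrite eqf_sqr => /orP[] /eqP ->; rewrite ?rmorphN phic.
have : 2 * d == 0 by rewrite mulr_natl mulr2n -[X in X + _]dF' dF addNr.
have d0 : d != 0 by rewrite /d !mulf_neq0 // subr_eq0 eq_sym.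
rewrite mulf_eq0 (negPf d0) orbF.
by rewrite -(rmorph_nat (in_alg L)) fmorph_eq0 (negPf two_neq0).
Qed.

(** * Irreducibility of quartics without roots *)

Lemma monic_quadraticE (R : nzRingType) (p : {poly R}) :
  p \is monic -> size p = 3%N -> p = 'X^2 + p`_1 *: 'X + (p`_0)%:P.
Proof.
move=> p_mon sp; apply/polyP => -[|[|[|i]]]; rewrite !coefE /=.
- by rewrite mulr0 !add0r.
- by rewrite mulr1 add0r addr0.
- by rewrite mulr0 !addr0; move/monicP: p_mon; rewrite /lead_coef sp.
- by rewrite nth_default ?sp // mulr0 !addr0.
Qed.

Lemma quartic_irreducible (F : fieldType) (f : {poly F}) :
    f \is monic -> size f = 5%N -> (forall x, ~~ root f x) ->
    (forall a b c d,
       f != ('X^2 + a *: 'X + b%:P) * ('X^2 + c *: 'X + d%:P)) ->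
  irreducible_poly f.
Proof.
move=> f_mon sf nroot nquad; split=> [|q sq1 qf]; first by rewrite sf.
have /dvdpP[r fE] := qf.
have f0 : f != 0 by rewrite -size_poly_eq0 sf.
have /andP[r0 q0] : (r != 0) && (q != 0).
  by move: f0; rewrite fE mulf_eq0 negb_or.
have nsize2 (p : {poly F}) : p %| f -> size p <> 2%N.
  move=> pf sp; have [x px] := poly2_root sp.
  by have := nroot x; case/dvdpP: pf => u ->; rewrite rootM px orbT.
have sqr : (size r + size q).-1 = 5%N by rewrite -size_mul // -fE.
have sq2 := nsize2 _ qf; have sr2 : size r <> 2%N.
  by apply: nsize2; rewrite fE dvdp_mulr.
have [sq|[sq sr]] : size q = 5%N \/ size q = 3%N /\ size r = 3%N.
  move: q0 r0 sqr sq2 sr2 sq1; rewrite -!size_poly_gt0.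
  by move: (size q) (size r) => m n; lia.
  by rewrite -dvdp_size_eqp // sq sf.
(* Moving the leading coefficient of [q] to [r] makes both quadratic factors monic. *)
pose l := lead_coef q; have l0 : l != 0 by rewrite lead_coef_eq0.
have fE' : f = (l *: r) * (l^-1 *: q).
  by rewrite -scalerAl -scalerAr scalerA mulfV // scale1r.
have q_mon : l^-1 *: q \is monic by rewrite monicE lead_coefZ mulVf.
have r_mon : l *: r \is monic by rewrite -(monicMr _ q_mon) -fE'.
have := nquad (l *: r)`_1 (l *: r)`_0 (l^-1 *: q)`_1 (l^-1 *: q)`_0.
by rewrite -!monic_quadraticE ?size_scale ?invr_eq0 // -fE' eqxx.
Qed.

(** In a splitting into two quadratics, neither has a root, so both have nonsquare discriminants.
    Their product is then a square, and so is the discriminant of [G]. *)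
Lemma G_irreducible (F : finFieldType) (s t : F) :
    2 != 0 :> F -> ~~ is_square (Gdisc s t) ->
    (forall x, ~~ root (G (s, t)) x) ->
  irreducible_poly (G (s, t)).
Proof.
move=> two_neq0 nd nroot.
have four_neq0 : 4 != 0 :> F by rewrite (natrM _ 2 2) mulf_neq0.
have quad_root (a b : F) : is_square (a ^+ 2 - 4 * b) ->
    exists x, root ('X^2 + a *: 'X + b%:P) x.
  case/is_squareP => e aE; exists ((e - a) / 2); apply/rootP; rewrite !hornerE /=.
  have -> : b = (a ^+ 2 - e ^+ 2) / 2 ^+ 2.
    by rewrite -aE; field.
  by field; rewrite ?two_neq0 ?four_neq0.
apply: quartic_irreducible => //; first exact: G_monic.
  exact: size_G.
move=> a b c d; apply/eqP => GE'.
have E : ('X^2 + a *: 'X + b%:P) * ('X^2 + c *: 'X + d%:P) =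
    'X^4 + (a + c) *: 'X^3 + (b + d + a * c) *: 'X^2 + (a * d + b * c) *: 'X
      + (b * d)%:P :> {poly F}.
  by rewrite -!mul_polyC !rmorphD !rmorphM /=; ring.
have C i := congr1 (fun p : {poly F} => p`_i) (etrans GE' E).
have := C 3%N; have := C 2%N; have := C 1%N; have := C 0%N; rewrite /= GE !coefE /=.
rewrite !(mulr0, mulr1, add0r, addr0, sub0r, subr0, oppr0, scale0r).
move=> e4 e3 e2 e1.
have dE : Gdisc s t = (a ^+ 2 - 4 * b) * (c ^+ 2 - 4 * d)
    * ((b - d) ^+ 2 + (a - c) * (a * d - b * c)) ^+ 2.
  by rewrite GdiscE; apply: quartic_disc_quadratics; rewrite -?e1 -?e2 -?e3 ?opprK.
have res0 : (b - d) ^+ 2 + (a - c) * (a * d - b * c) != 0.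
  apply: contraNneq nd => r0; rewrite dE r0 expr0n mulr0.
  by apply/is_squareP; exists 0; rewrite expr0n.
have [/quad_root[x rx]|na] := boolP (is_square (a ^+ 2 - 4 * b)).
  by have := nroot x; rewrite GE' rootM rx.
have [/quad_root[x rx]|nc] := boolP (is_square (c ^+ 2 - 4 * d)).
  by have := nroot x; rewrite GE' rootM rx orbT.
by move: nd; rewrite dE mulrC is_squareM2 // nonsquareM.
Qed.

(** * Ferrari's resolution and the absence of roots *)

(** The hypotheses say that [G] is [(X - x)^2 ((X - (1 - x))^2 - D)] with [D = 1 + 2 l + s]. This
    arises when both squares in Ferrari's form vanish at [x]. *)
Lemma G_root_double_disc (F : finFieldType) (s t l x : F) :
    x ^+ 2 - x + l = 0 -> t = l - (1 + 2 * l + s) * x ->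
    t = l ^+ 2 - (1 + 2 * l + s) * x ^+ 2 ->
  Gdisc s t = 0.
Proof.
move=> xE tE tE'; set D := 1 + 2 * l + s in tE tE'.
have lE : l = x - x ^+ 2 by rewrite -[LHS]subr0 -xE; ring.
have sE : s = D - 1 - 2 * l by rewrite /D; ring.
rewrite GdiscE (@quartic_disc_quadratics _ (- (2 * x)) (x ^+ 2)
  (- (2 * (1 - x))) ((1 - x) ^+ 2 - D)).
- by ring.
- by ring.
- by rewrite sE lE; ring.
- by rewrite tE lE; ring.
- by rewrite tE' lE; ring.
Qed.

(* Ferrari's resolution: when l is a root of the resolvent cubic,
   G = (X^2 - X + l)^2 - D (X + (t - l) / D)^2 with D = 1 + 2 l + s. *)
Lemma G_no_root_resolvent (F : finFieldType) (s t l : F) :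
    ~~ is_square (Gdisc s t) -> ~~ is_square (1 + 2 * l + s) ->
    (t - l) ^+ 2 = (1 + 2 * l + s) * (l ^+ 2 - t) ->
  forall x, ~~ root (G (s, t)) x.
Proof.
move=> nd nD lE x; apply/negP => /rootP; rewrite GE !hornerE /= => Gx.
set D := 1 + 2 * l + s in nD lE; have D0 := nonsquare_neq0 nD.
pose y := x + (t - l) / D.
have sE : s = D - 1 - 2 * l by rewrite /D; ring.
have E : (x ^+ 2 - x + l) ^+ 2 = D * y ^+ 2.
  apply/eqP; rewrite -subr_eq0; apply/eqP; rewrite -[RHS]Gx.
  have -> : D * y ^+ 2 = D * x ^+ 2 + 2 * (t - l) * x + (t - l) ^+ 2 / D.
    by rewrite /y; field.
  by rewrite lE [D * (l ^+ 2 - t)]mulrC mulfK // sE; ring.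
(* If [y] is nonzero, [E] makes [D] a square. If [y = 0], both squares vanish, [x] is a double root
   and the discriminant is [0], a square. *)
have [y0|y0] := eqVneq y 0.
  have tl : t - l = - (D * x).
    by rewrite -[LHS](divfK D0) -[_ / D](addKr x) -/y y0 addr0; ring.
  move/negP: nd; apply; have := E; rewrite y0 expr0n mulr0 => /eqP.
  rewrite sqrf_eq0 => /eqP x0; rewrite (@G_root_double_disc _ s t l x) //.
  - by apply/is_squareP; exists 0; rewrite expr0n.
  - by rewrite -[t](subrK l) tl -/D; ring.
  - apply/(mulfI D0)/eqP; rewrite -subr_eq0; apply/eqP.
    transitivity ((D * x) ^+ 2 - D * (l ^+ 2 - t)); first by rewrite -/D; ring.
    by rewrite -lE tl; ring.
by case/negP: nD; rewrite -(is_squareM2 _ y0) mulrC -E; exact: is_squareX2.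
Qed.

Lemma G_no_root_degenerate (F : finFieldType) (l : F) :
    ~~ is_square (l ^+ 2 - l) ->
  forall x, ~~ root (G (- 1 - 2 * l, l)) x.
Proof.
move=> nl x; apply/negP => /rootP; rewrite GE !hornerE /= => Gx.
case/negP: nl; apply/is_squareP; exists (x ^+ 2 - x + l).
by rewrite -[LHS]addr0 -Gx; ring.
Qed.

(** * The values of [theta] at irreducible [G] *)

Lemma Gdisc_theta (F : finFieldType) (s t : F) : t * (1 + s + t) != 0 ->
  Gdisc s t = (4 * (t * (1 + s + t))) ^+ 2 * (theta (s, t) - 27).
Proof.
rewrite mulf_eq0 negb_or => /andP[t0 w0].
by rewrite /Gdisc /theta /=; field; rewrite t0 w0.
Qed.

Lemma theta_mem_Theta_a (F : finFieldType) (s t : F) :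
    2 != 0 :> F -> t * (1 + s + t) != 0 -> ~~ is_square (theta (s, t) - 27) ->
    (forall x, ~~ root (G (s, t)) x) ->
  theta (s, t) \in Theta_a F.
Proof.
move=> two_neq0 u0 nth nroot; apply/imsetP; exists (s, t) => //.
rewrite inE inE /= u0 /=; apply/irreducibleP/G_irreducible => //.
by rewrite Gdisc_theta // is_squareM2 // mulf_neq0 // (natrM _ 2 2) mulf_neq0.
Qed.

Lemma Theta_a_nonsquare (F : finFieldType) (th : F) :
  2 != 0 :> F -> th \in Theta_a F -> ~~ is_square (th - 27).
Proof.
move=> two_neq0 /imsetP[[s t]]; rewrite inE inE /=.
case/andP=> u0 /irreducibleP G_irr ->.
have := irreducible_G_disc two_neq0 G_irr; rewrite Gdisc_theta // is_squareM2 //.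
by rewrite mulf_neq0 // (natrM _ 2 2) mulf_neq0.
Qed.

Lemma nonsquare_Theta_a (F : finFieldType) (th : F) :
  2 != 0 :> F -> ~~ is_square (th - 27) -> th \in Theta_a F.
Proof.
move=> two_neq0 nth; have four_neq0 : 4 != 0 :> F.
  by rewrite (natrM _ 2 2) mulf_neq0.
have [k kE] : exists k, k ^+ 3 = th * (k + 2).
  have [->|th0] := eqVneq th 0; first by exists 0; rewrite expr0n mul0r.
  have [|k kE] := @cubic_root_of_nonsquare_disc F (- th) (- (2 * th)).
    rewrite (_ : _ - _ = (2 * th) ^+ 2 * (th - 27)); last by ring.
    by rewrite is_squareM2 // mulf_neq0.
  by exists k; apply/eqP; rewrite -subr_eq0 -kE; apply/eqP; ring.
pose v := k + 2; have v0 : v != 0.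
  apply: contraNneq two_neq0 => v0; move: kE; rewrite -/v v0 mulr0 => /eqP.
  by rewrite expf_eq0 /= => /eqP k0; rewrite -v0 /v k0 add0r.
have thE : th = k ^+ 3 / v by rewrite kE mulfK.
(* This is the factorization [k^3 - 27 (k + 2) = (k - 6) (k + 3)^2]. *)
have nE : (th - 27) * v ^+ 2 = (k - 6) * v * (k + 3) ^+ 2.
  by rewrite thE /v in v0 *; field.
have k3 : k + 3 != 0.
  apply: contraNneq (nonsquare_neq0 nth) => k3; move/eqP: nE.
  by rewrite k3 expr0n mulr0 mulf_eq0 expf_eq0 /= (negPf v0) orbF.
have nk : ~~ is_square ((k - 6) * v).
  by rewrite -(is_squareM2 _ k3) mulrC -nE mulrC is_squareM2.
(* In the variable [x = 2 l], the factor [4 l^2 + (k - 2) l + 1] becomes [x^2 + b x + 1], and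
   [D = 1 + v l] becomes [v / 2 * (x - r)]. *)
pose b := (k - 2) / 2; pose r := - (2 / v).
have nd : ~~ is_square (b ^+ 2 - 4 * 1).
  rewrite -(is_squareM2 _ two_neq0) (_ : _ * _ = (k - 6) * v) //.
  by rewrite /b /v; field.
have mem s t l : s = k * l -> t * (1 + s + t) = v * l ^+ 3 -> l != 0 ->
    (~~ is_square (Gdisc s t) -> forall x, ~~ root (G (s, t)) x) ->
    th \in Theta_a F.
  move=> sE uE l0 nroot.
  have u0 : t * (1 + s + t) != 0 by rewrite uE mulf_neq0 ?expf_neq0.
  have thst : theta (s, t) = th.
    rewrite /theta /= uE sE thE; field; by rewrite l0 v0.
  rewrite -thst; apply: theta_mem_Theta_a; rewrite ?thst //; apply: nroot.
  by rewrite Gdisc_theta // is_squareM2 ?thst // mulf_neq0.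
have [sr|nr] := boolP (is_square (r ^+ 2 + b * r + 1)).
  have [x /andP[nD nQ]] := exists_nonsquare_values two_neq0 nd
    (mulf_neq0 v0 (invr_neq0 two_neq0)) sr.
  have /is_squareP[y yE] := nonsquareM two_neq0 nD nQ.
  (* Here [t] is a root of [t^2 + (1 + s) t = v l^3], whose discriminant [(1 + s)^2 + 4 v l^3]
     equals [D (4 l^2 + (k - 2) l + 1) = y^2]. *)
  pose l := x / 2; pose s := k * l; pose t := (y - 1 - s) / 2.
  have DE : v / 2 * (x - r) = 1 + 2 * l + s.
    by rewrite /s /l /r /v in v0 *; field; rewrite v0 two_neq0.
  have uE : t * (1 + s + t) = v * l ^+ 3.
    have -> : t * (1 + s + t) = (y ^+ 2 - (1 + s) ^+ 2) / 4.
      by rewrite /t; field; rewrite ?two_neq0 ?four_neq0.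
    rewrite -yE DE /s /l /b /v; field; by rewrite ?two_neq0 ?four_neq0.
  have l0 : l != 0.
    apply: contraNneq nD => l0; rewrite DE /s l0 !mulr0 !addr0.
    by apply/is_squareP; exists 1; rewrite expr1n.
  apply: (mem s t l) => // ng.
  apply: (G_no_root_resolvent ng (l := l)); first by rewrite -DE.
  (* Since [D - 1 = v l] and [D - 2 l = 1 + s], the resolvent equation is the equation for [t]
     rearranged. *)
  have : t ^+ 2 = v * l ^+ 3 - (1 + s) * t by rewrite -uE; ring.
  by rewrite sqrrB => ->; rewrite /s /v; ring.
(* At this zero of [D], [v l = -1] gives [k l = - 1 - 2 l], and [t = l] solves the equation for
   [t]. *)
pose l := - v^-1.
have l0 : l != 0 by rewrite oppr_eq0 invr_eq0.
apply: (mem (- 1 - 2 * l) l l) => //.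
- by rewrite /l /v in v0 *; field.
- by rewrite /l; field.
move=> _; apply: G_no_root_degenerate.
(* As [r = 2 l] and [(k - 2) l = - 1 - 4 l], the value of the quadratic at [r] is [4 (l^2 - l)]. *)
rewrite -(is_squareM2 _ two_neq0) (_ : _ * _ = r ^+ 2 + b * r + 1) //.
by rewrite /l /r /b /v in v0 *; field; rewrite ?v0 ?two_neq0.
Qed.

Theorem theorem6p11 (F : finFieldType) (q p k : nat)
    (p_prime : prime p) (p_ge5 : (5 <= p)%N) (k_gt0 : (0 < k)%N)
    (q_pow : q = (p ^ k)%N) (card_F : #|F| = q) :
  Theta_a F = [set 27%:R + a | a : F & ~~ is_square a] /\
  #|Theta_a F| = ((q - 1) %/ 2)%N.
Proof.
have two_neq0 : 2 != 0 :> F.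
  have pF : p \in [pchar F] by apply: (card_finPcharP (n := k)); rewrite ?card_F.
  by rewrite -(dvdn_pcharf pF) gtnNdvd // (leq_trans _ p_ge5).
have E : Theta_a F = [set 27%:R + a | a : F & ~~ is_square a].
  apply/setP => th; apply/idP/imsetP => [/(Theta_a_nonsquare two_neq0) nth|].
    by exists (th - 27); rewrite ?inE // addrC subrK.
  case=> a; rewrite inE => na ->; apply: nonsquare_Theta_a => //.
  by rewrite addrC addKr.
split=> //; rewrite E card_imset; last exact: addrI.
rewrite -card_F subn1 divn2 -(card_nonsquares two_neq0) doubleK.
by apply: eq_card => a; rewrite !inE.
Qed.
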